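(* Suppose the optimal value of the primal problem (P) is attained at some $\mathbf{y}^\star\in\bar{\mathcal{Y}}$ with $\mathbf{A}\mathbf{y}^\star=\mathbf{0}$. Let $\mathbf{y}\in\bar{\mathcal{Y}}$ and $\tilde{\mathbf{y}}=\frac1m(\mathbf{1}_{m\times m}\otimes\mathbf{I}_n)\,\mathbf{y}$. Then: 1. $\|\mathbf{y}-\mathbf{y}^\star\|\ge\|\tilde{\mathbf{y}}-\mathbf{y}^\star\|$. 2. $\tilde D\,\|\tilde{\mathbf{y}}-\mathbf{y}^\star\|\ge f(\tilde{\mathbf{y}})-f(\mathbf{y}^\star)$, where $$\tilde D=\sup_{\hat{\mathbf{y}}\in\bar{\mathcal{Y}},\ \mathbf{A}\hat{\mathbf{y}}=\mathbf{0}}\{\|\boldsymbol{\nu}\|\ :\ \boldsymbol{\nu}\in\partial f(\hat{\mathbf{y}})\}\in[0,\infty].$$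
   Context: Let $m\ge2$, $n\ge1$ be integers, $\mathcal{Y}\subseteq\mathbb{R}^n$ a closed convex set, and $f_i:\mathbb{R}^n\to\mathbb{R}$, $i=1,\dots,m$, strictly convex closed functions. For $\mathbf{y}=(\mathbf{y}_1,\dots,\mathbf{y}_m)\in(\mathbb{R}^n)^m=\mathbb{R}^{nm}$ put $f(\mathbf{y})=\sum_{i=1}^m f_i(\mathbf{y}_i)$, let $\bar{\mathcal{Y}}=\mathcal{Y}^m$, and $\mathbf{A}\mathbf{y}=(\mathbf{y}_1-\mathbf{y}_2,\dots,\mathbf{y}_{m-1}-\mathbf{y}_m)\in\mathbb{R}^{n(m-1)}$. Primal problem (P): minimize $f(\mathbf{y})$ subject to $\mathbf{y}\in\bar{\mathcal{Y}}$, $\mathbf{A}\mathbf{y}=\mathbf{0}$. $\partial f$ denotes the convex subdifferential, $\mathbf{1}_{m\times m}$ the all-ones matrix, $\otimes$ the Kronecker product (so every block of $\tilde{\mathbf{y}}$ is $\frac1m\sum_i\mathbf{y}_i$). Norms are Euclidean. The convention $\infty\cdot0=0$ is used if $\tilde D=\infty$. *)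

(* Defs.v *)
From mathcomp Require Export all_boot all_order all_algebra.
From mathcomp Require Export mxtens.
From mathcomp Require Export all_classical all_reals all_analysis.
Export numFieldNormedType.Exports.

Set Implicit Arguments.
Unset Strict Implicit.
Unset Printing Implicit Defensive.

Import Order.TTheory GRing.Theory Num.Theory.

Local Open Scope classical_set_scope.
Local Open Scope ring_scope.

Definition inner {R : realType} {d : nat} (u v : 'cV[R]_d) : R :=
  \sum_(k < d) u k 0 * v k 0.

(* The library norm `|u| on matrices is the sup norm. *)
Definition enorm {R : realType} {d : nat} (u : 'cV[R]_d) : R :=
  Num.sqrt (inner u u).

Definition strictly_convex {R : realType} {d : nat} (f : 'cV[R]_d -> R) : Prop :=
  forall (u v : 'cV[R]_d) (t : R), u != v -> 0 < t < 1 ->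
    f (t *: u + (1 - t) *: v) < t * f u + (1 - t) * f v.

(* Closedness of a function means closedness of its epigraph. *)
Definition closed_function {R : realType} {d : nat} (f : 'cV[R]_d -> R) : Prop :=
  closed [set p : 'cV[R]_d * R | f p.1 <= p.2].

Definition subdifferential {R : realType} {d : nat} (f : 'cV[R]_d -> R)
    (u : 'cV[R]_d) : set 'cV[R]_d :=
  [set nu | forall v, f u + inner nu (v - u) <= f v].

(* A vector of (R^n)^m is a column of height m * n made of m consecutive blocks
   of height n: coordinate j of block i sits at row i * n + j, the indexing used
   by the Kronecker product *t. *)
Definition block {R : realType} {m n : nat} (y : 'cV[R]_(m * n)) (i : 'I_m) :
    'cV[R]_n :=
  \col_(j < n) y (mxtens_index (i, j)) 0.

Definition stack {R : realType} {m n : nat} (v : 'I_m -> 'cV[R]_n) :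
    'cV[R]_(m * n) :=
  \col_(k < m * n) v (mxtens_unindex k).1 (mxtens_unindex k).2 0.

Definition ord_this {m : nat} (i : 'I_m.-1) : 'I_m := widen_ord (leq_pred m) i.

Definition ord_next {m : nat} (i : 'I_m.-1) : 'I_m :=
  Ordinal (etrans (esym (ltn_predRL i m)) (ltn_ord i)).

Definition consecutive_diff {R : realType} {m n : nat} (y : 'cV[R]_(m * n)) :
    'cV[R]_(m.-1 * n) :=
  stack (fun i : 'I_m.-1 => block y (ord_this i) - block y (ord_next i)).

Definition block_average {R : realType} {m n : nat} (y : 'cV[R]_(m * n)) :
    'cV[R]_(m * n) :=
  m%:R^-1 *: (((const_mx 1 : 'M[R]_m) *t (1%:M : 'M[R]_n)) *m y).

Definition separable_sum {R : realType} {m n : nat} (f : 'I_m -> 'cV[R]_n -> R)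
    (y : 'cV[R]_(m * n)) : R :=
  \sum_(i < m) f i (block y i).

Definition product_set {R : realType} {m n : nat} (Y : set 'cV[R]_n) :
    set 'cV[R]_(m * n) :=
  [set y | forall i : 'I_m, Y (block y i)].

Definition feasible {R : realType} {m n : nat} (Y : set 'cV[R]_n) :
    set 'cV[R]_(m * n) :=
  [set y | product_set Y y /\ consecutive_diff y = 0].

Definition primal_solution {R : realType} {m n : nat} (Y : set 'cV[R]_n)
    (f : 'I_m -> 'cV[R]_n -> R) (ystar : 'cV[R]_(m * n)) : Prop :=
  feasible Y ystar /\
  forall y, feasible Y y -> separable_sum f ystar <= separable_sum f y.

(* The supremum of the empty set is -oo in \bar R, so nonnegativity of
   subgradient_bound is not automatic. *)
Definition subgradient_bound {R : realType} {m n : nat} (Y : set 'cV[R]_n)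
    (f : 'I_m -> 'cV[R]_n -> R) : \bar R :=
  ereal_sup [set s : \bar R | exists (yhat nu : 'cV[R]_(m * n)),
    [/\ feasible Y yhat, subdifferential (separable_sum f) yhat nu
      & s = (enorm nu)%:E]].

(* Main.v *)
(* Block averaging is the orthogonal projection onto the consensus subspace, which
   contains [ystar]; this gives the first claim by Cauchy-Schwarz. A convex function
   that is finite on the whole space has a subgradient at every point, by a
   coordinate-by-coordinate Hahn-Banach extension. A subgradient at the averaged
   point, which is feasible because [Y] is convex, makes the supremum nonnegative and
   bounds the increase of the objective through Cauchy-Schwarz. *)

Require Import Defs.
From mathcomp Require Import unstable ring lra.

Import Order.TTheory GRing.Theory Num.Theory.
Local Open Scope classical_set_scope.
Local Open Scope ring_scope.

Lemma innerE {R : realType} {d : nat} (u v : 'cV[R]_d) :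
  inner u v = (u^T *m v) 0 0.
Proof. by rewrite mxE; apply: eq_bigr => k _; rewrite mxE. Qed.

Lemma innerC {R : realType} {d : nat} (u v : 'cV[R]_d) : inner u v = inner v u.
Proof. by apply: eq_bigr => k _; rewrite mulrC. Qed.

Lemma innerDr {R : realType} {d : nat} (u v w : 'cV[R]_d) :
  inner u (v + w) = inner u v + inner u w.
Proof. by rewrite !innerE mulmxDr mxE. Qed.

Lemma innerZr {R : realType} {d : nat} (u v : 'cV[R]_d) (a : R) :
  inner u (a *: v) = a * inner u v.
Proof. by rewrite !innerE -scalemxAr mxE. Qed.

Lemma innerDl {R : realType} {d : nat} (u v w : 'cV[R]_d) :
  inner (u + v) w = inner u w + inner v w.
Proof. by rewrite innerC innerDr !(innerC w). Qed.

Lemma innerZl {R : realType} {d : nat} (u v : 'cV[R]_d) (a : R) :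
  inner (a *: u) v = a * inner u v.
Proof. by rewrite innerC innerZr innerC. Qed.

Lemma inner_delta {R : realType} {d : nat} (u : 'cV[R]_d) (k : 'I_d) :
  inner u (delta_mx k 0) = u k 0.
Proof.
rewrite /inner (bigD1 k)//= big1 ?addr0 ?mxE ?eqxx ?mulr1// => i /negPf ik.
by rewrite mxE ik mulr0.
Qed.

Lemma inner_mulmxl {R : realType} {d e : nat} (A : 'M[R]_(e, d)) (u : 'cV_d)
  (v : 'cV_e) : inner (A *m u) v = inner u (A^T *m v).
Proof. by rewrite !innerE trmx_mul mulmxA. Qed.

Lemma inner_ge0 {R : realType} {d : nat} (u : 'cV[R]_d) : 0 <= inner u u.
Proof. by apply: sumr_ge0 => k _; rewrite -expr2 sqr_ge0. Qed.

Lemma enorm_ge0 {R : realType} {d : nat} (u : 'cV[R]_d) : 0 <= enorm u.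
Proof. exact: sqrtr_ge0. Qed.

Lemma enorm_sqr {R : realType} {d : nat} (u : 'cV[R]_d) :
  enorm u ^+ 2 = inner u u.
Proof. by rewrite sqr_sqrtr ?inner_ge0. Qed.

Lemma enorm_eq0 {R : realType} {d : nat} (u : 'cV[R]_d) :
  enorm u = 0 -> u = 0.
Proof.
move=> u0; have /eqP : inner u u = 0 by rewrite -enorm_sqr u0 expr0n.
rewrite psumr_eq0 => [/allP u20|k _]; last by rewrite -expr2 sqr_ge0.
apply/colP => k; rewrite mxE; apply/eqP.
by have := u20 k (mem_index_enum k); rewrite /= mulf_eq0 orbb.
Qed.

Lemma Cauchy_Schwarz {R : realType} {d : nat} (u v : 'cV[R]_d) :
  inner u v <= enorm u * enorm v.
Proof.
have [/enorm_eq0 ->|u0] := eqVneq (enorm u) 0.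
  by rewrite -[X in inner X v](scale0r 0) innerZl mul0r mulr_ge0 ?enorm_ge0.
have [/enorm_eq0 ->|v0] := eqVneq (enorm v) 0.
  by rewrite -[X in inner u X](scale0r 0) innerZr mul0r mulr_ge0 ?enorm_ge0.
have uv_gt0 : 0 < enorm u * enorm v by rewrite mulr_gt0// lt0r ?u0 ?v0 enorm_ge0.
have := inner_ge0 (enorm v *: u + (- enorm u) *: v).
rewrite !(innerDl, innerDr, innerZl, innerZr) (innerC v u) -!enorm_sqr => h.
by rewrite -(ler_pM2l uv_gt0); nra.
Qed.

Section Subgradient.
Context {R : realType}.

Lemma convex_functionTE {E : lmodType R} (g : E -> R) :
  convex_function [set: E] g <-> forall (t : {i01 R}) u v,
    g (t%:num *: u + (1 - t%:num) *: v) <= t%:num * g u + (1 - t%:num) * g v.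
Proof.
by split=> g_convex t u v; [exact: g_convex t u v (in_setT _) (in_setT _)|
  move=> _ _; exact: g_convex].
Qed.

Lemma convex_function_weighted {E : lmodType R} {g : E -> R}
    (g_convex : convex_function [set: E] g) (u v : E) {r s : R} :
  0 < r -> 0 < s ->
  (r + s) * g ((r + s)^-1 *: (r *: u + s *: v)) <= r * g u + s * g v.
Proof.
move=> r0 s0; have rs0 : 0 < r + s by rewrite addr_gt0.
have t0 : 0 <= r / (r + s) by rewrite divr_ge0// ltW.
have t1 : r / (r + s) <= 1 by rewrite ler_pdivrMr// mul1r lerDl ltW.
have /convex_functionTE/(_ (Itv01 t0 t1) u v)/= := g_convex.
have -> : 1 - r / (r + s) = s / (r + s) by field; rewrite gt_eqF.
rewrite scalerDr !scalerA -!(mulrC (r + s)^-1) -(ler_pM2l rs0).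
by rewrite [X in _ <= X]mulrDr !mulrA divff ?gt_eqF// !mul1r.
Qed.

(* One step of the Hahn-Banach argument: the slope [c] along [e] is squeezed
   between the difference quotients taken in the directions [- e] and [e]. *)
Lemma linear_minorant_extend {E : lmodType R} {g : E -> R}
    (g_convex : convex_function [set: E] g) (S : set E) (l : E -> R) (e : E)
    (S0 : S 0) (SD : forall u v a b, S u -> S v -> S (a *: u + b *: v))
    (l_linear : forall u v a b, l (a *: u + b *: v) = a * l u + b * l v)
    (l_le : forall u, S u -> l u <= g u) :
  exists c : R, forall u (s : R), S u -> l u + s * c <= g (u + s *: e).
Proof.
pose L := [set x : R | exists u (r : R), [/\ S u, 0 < r &
  x = (l u - g (u - r *: e)) / r]].
have L_le u (s : R) : S u -> 0 < s -> ubound L ((g (u + s *: e) - l u) / s).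
  move=> Su s0 _ [v [r [Sv r0 ->]]].
  rewrite ler_pdivrMr// mulrAC ler_pdivlMr//.
  have rs0 : 0 < r + s by rewrite addr_gt0.
  have := convex_function_weighted g_convex (u + s *: e) (v - r *: e) r0 s0.
  have -> : r *: (u + s *: e) + s *: (v - r *: e) = r *: u + s *: v.
    by rewrite !scalerDr scalerN !scalerA (mulrC s) addrACA subrr addr0.
  have := l_le _ (SD _ _ 0 (r + s)^-1 S0 (SD u v r s Su Sv)).
  rewrite scaler0 add0r -(ler_pM2l rs0) => /le_trans h /h.
  have -> : (r + s)^-1 *: (r *: u + s *: v) =
      (r / (r + s)) *: u + (s / (r + s)) *: v.
    by rewrite scalerDr !scalerA !(mulrC (r + s)^-1).
  rewrite l_linear.
  have -> : (r + s) * (r / (r + s) * l u + s / (r + s) * l v) =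
      r * l u + s * l v by field; rewrite gt_eqF.
  by move=> ?; lra.
have L_nonempty : L !=set0.
  by exists ((l 0 - g (0 - 1 *: e)) / 1); exists 0, 1; split.
have L_bounded : has_ubound L by eexists; exact: (L_le 0 1 S0 ltr01).
exists (sup L) => u s Su; have [s0|s0|->] := ltgtP s 0.
- have Lx : L ((l u - g (u + s *: e)) / (- s)).
    by exists u, (- s); split; rewrite ?oppr_gt0// scaleNr opprK.
  have := ub_le_sup L_bounded Lx.
  by rewrite ler_pdivrMr ?oppr_gt0// => ?; lra.
- have := ge_sup L_nonempty (L_le u s Su s0).
  by rewrite ler_pdivlMr// => ?; lra.
- by rewrite mul0r scale0r !addr0 l_le.
Qed.

Lemma convex_linear_minorant {d : nat} {g : 'cV[R]_d -> R}
    (g_convex : convex_function [set: 'cV[R]_d] g) (g0 : 0 <= g 0) :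
  exists nu, forall v, inner nu v <= g v.
Proof.
pose S k := [set v : 'cV[R]_d | forall i : 'I_d, (k <= i)%N -> v i 0 = 0].
suff /(_ d (leqnn d)) [nu nu_le] : forall k, (k <= d)%N ->
    exists nu, forall v, S k v -> inner nu v <= g v.
  by exists nu => v; apply: nu_le => i; rewrite leqNgt ltn_ord.
elim=> [_|k IH k_lt].
  exists 0 => v Sv; rewrite (_ : v = 0); last by apply/colP => i; rewrite Sv ?mxE.
  by rewrite -[X in inner X _](scale0r 0) innerZl mul0r.
have [nu nu_le] := IH (ltnW k_lt); pose o := Ordinal k_lt.
have [||//|c c_le] := @linear_minorant_extend _ _ g_convex (S k) (inner nu)
    (delta_mx o 0) _ _ _ nu_le.
- by move=> i _; rewrite mxE.
- by move=> u v a b Su Sv i ki; rewrite !mxE Su// Sv// !mulr0 addr0.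
- by move=> u v a b; rewrite innerDr !innerZr.
exists (nu + (c - nu o 0) *: delta_mx o 0) => v Sv.
pose w := v - v o 0 *: delta_mx o 0.
have Sw : S k w.
  move=> i; rewrite leq_eqVlt => /orP[/eqP ki|ki].
    have -> : i = o by apply: val_inj.
    by rewrite !mxE !eqxx mulr1 subrr.
  have /negPf io : i != o by rewrite -val_eqE gtn_eqF.
  by rewrite !mxE (Sv i ki) io mulr0 subr0.
have -> : v = w + v o 0 *: delta_mx o 0 by rewrite subrK.
apply: le_trans (c_le w (v o 0) Sw).
rewrite !(innerDl, innerDr, innerZl, innerZr) !(innerC (delta_mx o 0)).
rewrite !inner_delta !mxE !eqxx.
by rewrite le_eqVlt; apply/orP; left; apply/eqP; ring.
Qed.

Lemma subdifferential_nonempty {d : nat} {f : 'cV[R]_d -> R}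
    (f_convex : convex_function [set: 'cV[R]_d] f) (u : 'cV[R]_d) :
  subdifferential f u !=set0.
Proof.
have [||nu nu_le] := @convex_linear_minorant _ (fun v => f (u + v) - f u).
- apply/convex_functionTE => t v w.
  have /convex_functionTE/(_ t (u + v) (u + w)) := f_convex.
  rewrite !scalerDr addrACA -scalerDl subrKC scale1r.
  by move=> ?; lra.
- by rewrite addr0 subrr.
by exists nu => v; have := nu_le (v - u); rewrite subrKC => ?; lra.
Qed.

Lemma strictly_convex_convex {d : nat} {f : 'cV[R]_d -> R} :
  strictly_convex f -> convex_function [set: 'cV[R]_d] f.
Proof.
move=> f_strict t u v _ _; have [->|uv] := eqVneq u v; first by rewrite !convmm.
have [->|t0] := eqVneq t 0%:i01; first by rewrite !conv0.
have [->|t1] := eqVneq t 1%:i01; first by rewrite !conv1.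
apply/ltW/f_strict => //; apply/andP; split.
- by rewrite lt_neqAle eq_sym t0 ge0.
- by rewrite lt_neqAle t1 le1.
Qed.

End Subgradient.

Section Blocks.
Context {R : realType} {m n : nat}.
Implicit Types (y z : 'cV[R]_(m * n)) (Y : set 'cV[R]_n).

Lemma block_inj y z : block y =1 block z -> y = z.
Proof.
move=> yz; apply/colP => k; case: (mxtens_indexP k) => i j.
by have /colP/(_ j) := yz i; rewrite !mxE.
Qed.

Lemma separable_sum_convex {f : 'I_m -> 'cV[R]_n -> R} :
  (forall i, convex_function [set: 'cV[R]_n] (f i)) ->
  convex_function [set: 'cV[R]_(m * n)] (separable_sum f).
Proof.
move=> f_convex; apply/convex_functionTE => t u v; rewrite /separable_sum.
rewrite !mulr_sumr -big_split; apply: ler_sum => i _ /=.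
have /convex_functionTE/(_ t (block u i) (block v i)) := f_convex i.
apply: le_trans.
by rewrite le_eqVlt; apply/orP; left; apply/eqP; congr (f i _);
  apply/colP => j; rewrite !mxE.
Qed.

Lemma block_averageE y (i : 'I_m) :
  block (block_average y) i = m%:R^-1 *: \sum_k block y k.
Proof.
apply/colP => j; rewrite mxE /block_average mxE [RHS]mxE summxE.
congr (_ * _); rewrite mxE.
have idxK : {on [pred _ | true], bijective (@mxtens_index m n)}.
  by exists (@mxtens_unindex m n) => ? _;
    rewrite ?(mxtens_indexK, mxtens_unindexK).
rewrite (reindex _ idxK)/=.
pose F k l := ((const_mx 1 : 'M[R]_m) *t (1%:M : 'M[R]_n)) (mxtens_index (i, j))
  (mxtens_index (k, l)) * y (mxtens_index (k, l)) 0.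
rewrite (eq_bigr (fun p => F p.1 p.2)) => [|[k l] _ //].
rewrite -(pair_bigA _ F)/= /F.
apply: eq_bigr => k _; rewrite (bigD1 j)//= big1 => [|l /negPf lj].
  by rewrite tensmxE !mxE eqxx !mul1r addr0.
by rewrite tensmxE !mxE eq_sym lj mulr0 mul0r.
Qed.

Lemma block_averageB y z :
  block_average (y - z) = block_average y - block_average z.
Proof. by rewrite /block_average mulmxBr scalerBr. Qed.

Lemma consecutive_diff_eq0 y :
  consecutive_diff y = 0 <-> forall i j, block y i = block y j.
Proof.
split=> [y0|y_eq]; last first.
  by apply/colP => k; rewrite mxE (y_eq _ (ord_next (mxtens_unindex k).1))
    subrr !mxE.
have step (i : 'I_m.-1) : block y (ord_this i) = block y (ord_next i).
  apply/eqP; rewrite -subr_eq0; apply/eqP/colP => j.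
  have /colP/(_ (mxtens_index (i, j))) := y0.
  by rewrite [LHS]mxE mxtens_indexK/= => ->; rewrite !mxE.
suff from0 k (k_lt : (k < m)%N) (m_gt0 : (0 < m)%N) :
    block y (Ordinal k_lt) = block y (Ordinal m_gt0).
  move=> [i i_lt] [j j_lt]; have m_gt0 : (0 < m)%N := leq_ltn_trans (leq0n _) i_lt.
  by rewrite (from0 _ _ m_gt0) (from0 _ j_lt m_gt0).
elim: k k_lt => [k_lt|k IH k_lt]; first by congr block; exact: val_inj.
have k_lt' : (k < m.-1)%N by rewrite ltn_predRL.
rewrite -(IH (ltnW k_lt)).
have := step (Ordinal k_lt').
rewrite (_ : ord_this _ = Ordinal (ltnW k_lt)); last exact: val_inj.
by rewrite (_ : ord_next _ = Ordinal k_lt) => [->|]; last exact: val_inj.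
Qed.

Lemma block_average_id y : consecutive_diff y = 0 -> block_average y = y.
Proof.
move=> /consecutive_diff_eq0 y_eq; apply: block_inj => i.
have m_neq0 : m%:R != 0 :> R by rewrite pnatr_eq0 -lt0n (leq_ltn_trans _ (ltn_ord i)).
rewrite block_averageE (eq_bigr (fun=> block y i)) => [|k _]; last exact: y_eq.
by rewrite sumr_const card_ord -(scaler_nat _ (block y i)) scalerA mulVf// scale1r.
Qed.

Lemma consecutive_diff_average y : consecutive_diff (block_average y) = 0.
Proof. by apply/consecutive_diff_eq0 => i j; rewrite !block_averageE. Qed.

(* Averaging is a symmetric idempotent, hence an orthogonal projection. *)
Lemma enorm_block_average y : enorm (block_average y) <= enorm y.
Proof.
have [->|avg_neq0] := eqVneq (enorm (block_average y)) 0; first exact: enorm_ge0.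
have avg_gt0 : 0 < enorm (block_average y) by rewrite lt0r avg_neq0 enorm_ge0.
rewrite -(ler_pM2r avg_gt0); apply: le_trans (Cauchy_Schwarz _ _).
pose J : 'M[R]_(m * n) := const_mx 1 *t 1%:M.
have JT : J^T = J by rewrite trmx_tens trmx_const trmx1.
have JJ : J *m J = m%:R *: J.
  rewrite tensmx_mul mulmx1; apply/matrixP => k l; rewrite !mxE mulrA.
  congr (_ * _); rewrite mulr1 (eq_bigr (fun=> 1)) => [|h _].
    by rewrite sumr_const card_ord.
  by rewrite !mxE mulr1.
rewrite -expr2 enorm_sqr /block_average -/J innerZl !innerZr.
rewrite inner_mulmxl JT mulmxA JJ -scalemxAl innerZr.
have [m0|m_neq0] := eqVneq (m%:R : R) 0; first by rewrite m0 invr0 !mul0r.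
by rewrite (mulrA m%:R^-1 m%:R) mulVf// mul1r.
Qed.

End Blocks.

Lemma convex_set_mean {R : realType} {E : lmodType R} {Y : set E} {k : nat}
    {v : 'I_k -> E} :
  convex_set Y -> (0 < k)%N -> (forall i, Y (v i)) ->
  Y (k%:R^-1 *: \sum_(i < k) v i).
Proof.
move=> Y_convex; case: k v => [//|k] v _; elim: k v => [|k IH] v Yv.
  by rewrite big_ord1 invr1 scale1r.
have t0 : 0 <= k.+1%:R / k.+2%:R :> R by rewrite divr_ge0.
have t1 : k.+1%:R / k.+2%:R <= 1 :> R.
  by rewrite ler_pdivrMr ?ltr0n// mul1r ler_nat.
have := Y_convex _ _ (Itv01 t0 t1) (mem_set (IH _ (fun i => Yv (widen_ord (leqnSn _) i))))
  (mem_set (Yv ord_max)).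
rewrite inE /conv/= /onem scalerA mulrAC divff ?pnatr_eq0// mul1r.
have -> : 1 - k.+1%:R / k.+2%:R = k.+2%:R^-1 :> R.
  rewrite -[X in X - _](@divff _ k.+2%:R) ?pnatr_eq0// -mulrBl -natrB//.
  by rewrite subSnn mul1r.
by rewrite [in X in _ -> X]big_ord_recr/= scalerDr.
Qed.

Theorem lemma4 (R : realType) (m n : nat) (hm : (2 <= m)%N) (hn : (1 <= n)%N)
    (Y : set 'cV[R]_n) (Y_closed : closed Y) (Y_convex : convex_set Y)
    (f : 'I_m -> 'cV[R]_n -> R)
    (f_strict : forall i : 'I_m, strictly_convex (f i))
    (f_closed : forall i : 'I_m, closed_function (f i))
    (ystar : 'cV[R]_(m * n)) (ystar_opt : primal_solution Y f ystar)
    (y : 'cV[R]_(m * n)) (hy : product_set Y y) :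
  enorm (y - ystar) >= enorm (block_average y - ystar) /\
  (0 <= subgradient_bound Y f)%E /\
  (subgradient_bound Y f * (enorm (block_average y - ystar))%:E
     >= (separable_sum f (block_average y) - separable_sum f ystar)%:E)%E.
Proof.
have [[_ ystar_consensus] _] := ystar_opt.
have feasible_avg : feasible Y (block_average y).
  split=> [i|]; last exact: consecutive_diff_average.
  by rewrite block_averageE; apply: convex_set_mean => //; exact: ltnW.
have [nu nu_sub] := subdifferential_nonempty (separable_sum_convex
  (fun i => strictly_convex_convex (f_strict i))) (block_average y).
have nu_le : ((enorm nu)%:E <= subgradient_bound Y f)%E.
  by apply: ereal_sup_ubound; exists (block_average y), nu.
split; [|split].
- rewrite -{1}(block_average_id _ ystar_consensus) -block_averageB.
  exact: enorm_block_average.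
- by apply: le_trans nu_le; rewrite lee_fin enorm_ge0.
- apply: le_trans (lee_wpmul2r _ nu_le); last by rewrite lee_fin enorm_ge0.
  rewrite -EFinM lee_fin; have := nu_sub ystar.
  have := Cauchy_Schwarz nu (block_average y - ystar).
  by rewrite -opprB -scaleN1r innerZr => ? ?; lra.
Qed.
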